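(* Let $n\ge1$. For a decorated Dyck path $(f,g)$, write $g^{-1}(0)=\{i_1,\dots,i_k\}$ and $g^{-1}(1)=\{j_1,\dots,j_l\}$ with $i_1<\cdots<i_k$ and $j_1<\cdots<j_l$. The map $$(f,g)\mapsto \left(R_{[j_l,f(j_l)]}\cdots R_{[j_1,f(j_1)]}\right)^{-1}R_{[i_k,f(i_k)]}\cdots R_{[i_1,f(i_1)]}$$ is a bijection between the decorated Dyck paths (for the given $n$) and the smooth permutations in $S_n$. Moreover, the expression on the right-hand side is reduced, i.e. the length of the product is the sum of the lengths of the factors $R_{[i,f(i)]}^{\pm1}$, $i\in[n]$.
   Context: $S_n$ is the group of permutations of $[n]=\{1,\dots,n\}$, products being composition of functions, $(\sigma\tau)(i)=\sigma(\tau(i))$; $\ell(\sigma)=\#\{i<j:\sigma(i)>\sigma(j)\}$ is the length. The Bruhat order is: $\tau\le\sigma$ iff $\#(\tau([i])\cap[j])\ge\#(\sigma([i])\cap[j])$ for all $i,j$. A permutation $\sigma$ is smooth if $\ell(\sigma)$ equals the number of transpositions $T\in S_n$ with $T\le\sigma$ (equivalently, as is known, $\sigma$ avoids $4231$ and $3412$). A Dyck path is identified with a weakly increasing function $f:[n]\to[n]$ with $f(i)\ge i$ for all $i$. A decorated Dyck path is a pair $(f,g)$ of such a function $f$ and a function $g:[n]\to\{0,1\}$ such that (1) $g(i)=0$ whenever $f(f(i))=f(i)$; (2) $g(i)=g(i+1)$ whenever $i<n$ and $f(i+1)<f(f(i))$. For $1\le i<j\le n$, $R_{[i,j]}\in S_n$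 is the cycle $i\mapsto i+1\mapsto\cdots\mapsto j\mapsto i$ (fixing all other elements), and $R_{[i,i]}$ is the identity. *)

(* Defs.v *)
From mathcomp Require Import all_boot all_fingroup.
From mathcomp Require Import zify.

Set Implicit Arguments.
Unset Strict Implicit.
Unset Printing Implicit Defensive.

Local Open Scope group_scope.

(* [n] = {1, ..., n} is represented by 'I_n, shifted by one; [i] is then
   initial_segment i. *)

Definition initial_segment n (i : 'I_n) : {set 'I_n} := [set k : 'I_n | k <= i].

Definition perm_length n (s : 'S_n) : nat :=
  #|[set p : 'I_n * 'I_n | (p.1 < p.2) && (s p.1 > s p.2)]|.

Definition bruhat_le n (t s : 'S_n) : bool :=
  [forall i : 'I_n, forall j : 'I_n,
     #|(t @: initial_segment i) :&: initial_segment j|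
       >= #|(s @: initial_segment i) :&: initial_segment j|].

Definition transpositions n : {set 'S_n} :=
  [set t | [exists i : 'I_n, exists j : 'I_n, (i != j) && (t == tperm i j)]].

Definition smooth n (s : 'S_n) : bool :=
  perm_length s == #|[set t in transpositions n | bruhat_le t s]|.

(* The inner test i <= j only serves to make interval_cycle i j a permutation
   (the identity) in the irrelevant case j < i.  For k < j, ordS k is k + 1. *)
Definition interval_cycle_fun n (i j k : 'I_n) : 'I_n :=
  if i <= k < j then ordS k
  else if (i <= j) && (k == j) then i else k.

Lemma interval_cycle_fun_inj n (i j : 'I_n) : injective (interval_cycle_fun i j).
Proof.
have ordSE (k : 'I_n) : k < j -> ordS k = k.+1 :> nat.
  by move=> kj; rewrite /= modn_small // (leq_ltn_trans kj).
have valE (k : 'I_n) : interval_cycle_fun i j k =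
    (if i <= k < j then k.+1 else if (i <= j) && (k == j :> nat) then i else k)
    :> nat.
  rewrite /interval_cycle_fun; case: ifP => [/andP[_ /ordSE //]|_].
  by rewrite -val_eqE /=; case: ifP.
move=> a b /(congr1 (@nat_of_ord n)); rewrite !valE => ab; apply: val_inj => /=.
move: ab.
case: (leqP i a); case: (leqP i b); case: (ltngtP a j); case: (ltngtP b j);
  case: (leqP i j) => //=; do ?[by move=> *; subst]; lia.
Qed.

(* The cycle R_[i,j] : i |-> i + 1 |-> ... |-> j |-> i. *)
Definition interval_cycle n (i j : 'I_n) : 'S_n :=
  perm (@interval_cycle_fun_inj n i j).

Definition dyck_path n (f : {ffun 'I_n -> 'I_n}) : bool :=
  [forall i : 'I_n, i <= f i]
  && [forall i : 'I_n, forall j : 'I_n, (i <= j) ==> (f i <= f j)].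

Definition decorated_dyck_path n
    : {set {ffun 'I_n -> 'I_n} * {ffun 'I_n -> bool}} :=
  [set fg : {ffun 'I_n -> 'I_n} * {ffun 'I_n -> bool} |
     let: (f, g) := fg in
     [&& dyck_path f,
         [forall i : 'I_n, (f (f i) == f i) ==> (g i == false)]
       & [forall i : 'I_n, forall i' : 'I_n,
            (i' == i.+1 :> nat) && (f i' < f (f i)) ==> (g i == g i')]]].

(* In 'S_n the product is (s * t) k = t (s k), so a product of permutations
   written as a composition of functions appears here with its factors in the
   opposite order: R_[i_k,f(i_k)] ... R_[i_1,f(i_1)] (composition, leftmost
   factor applied last) is the \prod below, taken along increasing indices, and
   A^-1 B (composition) is B * A^-1. *)
Definition dyck_perm n (fg : {ffun 'I_n -> 'I_n} * {ffun 'I_n -> bool}) : 'S_n :=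
  let: (f, g) := fg in
  (\prod_(i < n | g i == false) interval_cycle i (f i))
  * (\prod_(i < n | g i == true) interval_cycle i (f i))^-1.

Definition dyck_factor n (f : {ffun 'I_n -> 'I_n}) (g : {ffun 'I_n -> bool})
    (i : 'I_n) : 'S_n :=
  if g i then (interval_cycle i (f i))^-1 else interval_cycle i (f i).

(* Main.v *)
Require Import Defs.
From mathcomp Require Import all_boot all_fingroup.
From mathcomp Require Import zify.

(* For a permutation s let h(k) be the smaller of max s([k]) and max s^-1([k]).
   A transposition (a b) with a < b lies below s iff b <= h(a), so s is smooth
   iff its length is the sum of the h(k) - k.

   If s fixes 1, ..., p-1 and s^-1(p) <= s(p), put m = s^-1(p) and write
   s = s' R_[p,m], so that s' also fixes p.  Then the length drops by m - p, the
   value h(p) = m becomes p, and no other h(k) increases.  Induction on p gives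
   l(s) <= sum (h(k) - k), and in the equality case s' is again smooth with the
   same h away from p.  The case s(p) < s^-1(p) follows by passing to s^-1, and
   the choice between the two cases is the decoration: (f, g) is recovered from
   its permutation as f = h and, where f(f(k)) <> f(k), g(k) = 1 iff
   max s([k]) < max s^-1([k]). *)

Set Implicit Arguments.
Unset Strict Implicit.
Unset Printing Implicit Defensive.

(** * Running maxima, hulls and interval cycles *)

Local Ltac split_ifs_lia :=
  repeat (let H := fresh in case: ifP => H); lia.

(** The index [k] is a natural number so that [k.+1] needs no bound; as indices start at 0, the
    maximum is over the first [k + 1] points. *)
Definition running_max n (s : 'S_n) (k : nat) : nat :=
  \max_(i < n | i <= k) s i.

Definition hull n (s : 'S_n) (k : nat) : nat :=
  minn (running_max s k) (running_max s^-1 k).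

Definition fixes_below n (p : nat) (s : 'S_n) : Prop :=
  forall k : 'I_n, k < p -> s k = k.

Lemma interval_cycleE n (i j k : 'I_n) :
  interval_cycle i j k =
    (if i <= k < j then k.+1 else if (i <= j) && (k == j :> nat) then i else k)
    :> nat.
Proof.
rewrite permE /interval_cycle_fun; case: ifP => [/andP[_ kj]|_].
  by rewrite /= modn_small // (leq_ltn_trans kj).
by rewrite -val_eqE /=; case: ifP.
Qed.

Lemma interval_cycleVE n (i j k : 'I_n) : i <= j ->
  ((interval_cycle i j)^-1)%g k =
    (if i < k <= j then k.-1 else if k == i :> nat then j else k) :> nat.
Proof.
move=> le_ij; set l := ((interval_cycle i j)^-1)%g k.
have : interval_cycle i j l = k by rewrite /l permKV.
move=> /(congr1 (@nat_of_ord n)); rewrite interval_cycleE le_ij /=.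
split_ifs_lia.
Qed.

Lemma interval_cycle_id n (i : 'I_n) : interval_cycle i i = 1%g.
Proof.
apply/permP => k; apply: val_inj; rewrite /= interval_cycleE perm1.
case: ifP => [|_]; first lia.
by case: ifP => // /andP[_ /eqP].
Qed.

Lemma permVM n (s t : 'S_n) (k : 'I_n) :
  ((s * t)^-1)%g k = (s^-1)%g ((t^-1)%g k).
Proof. by rewrite invMg permM. Qed.

Lemma fixes_belowV n p (s : 'S_n) : fixes_below p s -> fixes_below p s^-1%g.
Proof. by move=> fix_s k /fix_s sk; rewrite -{1}sk permK. Qed.

Lemma running_max_leP n (s : 'S_n) k v :
  reflect (forall i : 'I_n, i <= k -> s i <= v) (running_max s k <= v).
Proof. exact: bigmax_leqP. Qed.

Lemma leq_running_max n (s : 'S_n) (i : 'I_n) k :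
  i <= k -> s i <= running_max s k.
Proof. by move=> ?; apply: leq_bigmax_cond. Qed.

Lemma running_max_mono n (s : 'S_n) k l :
  k <= l -> running_max s k <= running_max s l.
Proof.
move=> le_kl; apply/running_max_leP => i le_ik.
by apply: leq_running_max; apply: leq_trans le_kl.
Qed.

Lemma running_max_lt n (s : 'S_n) k : 0 < n -> running_max s k < n.
Proof.
by case: n s => // n s _; apply/running_max_leP => i _; rewrite -ltnS.
Qed.

Lemma mem_initial_segment n (i k : 'I_n) :
  (k \in initial_segment i) = (k <= i).
Proof. by rewrite inE. Qed.

Lemma card_initial_segment n (i : 'I_n) : #|initial_segment i| = i.+1.
Proof.
rewrite -sum1_card (eq_bigl (fun k : 'I_n => k < i.+1)); last first.
  by move=> k; rewrite inE.
by rewrite -(big_ord_widen n (fun=> 1) (ltn_ord i)) sum1_card card_ord.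
Qed.

(** Pigeonhole: [s] embeds the [k + 1] points up to [k] in the segment up to the running maximum. *)
Lemma running_max_ge n (s : 'S_n) (k : 'I_n) : k <= running_max s k.
Proof.
have n_gt0 : 0 < n by apply: leq_ltn_trans (ltn_ord k).
pose m := Ordinal (running_max_lt s k n_gt0).
have : s @: initial_segment k \subset initial_segment m.
  apply/subsetP => _ /imsetP[i ik ->]; rewrite mem_initial_segment.
  by apply: leq_running_max; rewrite -mem_initial_segment.
move/subset_leq_card.
by rewrite card_imset ?card_initial_segment //; apply: perm_inj.
Qed.

(** A segment mapped into itself by [s] is mapped onto itself, by cardinality. *)
Lemma running_maxV_le n (s : 'S_n) (k : 'I_n) :
  running_max s k <= k -> running_max s^-1 k <= k.
Proof.
move/running_max_leP => s_k; apply/running_max_leP => i le_ik.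
have eq_im : s @: initial_segment k = initial_segment k.
  apply/eqP; rewrite eqEcard card_imset ?leqnn ?andbT; last exact: perm_inj.
  apply/subsetP => _ /imsetP[j jk ->]; rewrite mem_initial_segment.
  by apply: s_k; rewrite -mem_initial_segment.
have : i \in s @: initial_segment k by rewrite eq_im mem_initial_segment.
by case/imsetP => j jk ->; rewrite permK -mem_initial_segment.
Qed.

Lemma hullV n (s : 'S_n) k : hull s^-1 k = hull s k.
Proof. by rewrite /hull invgK minnC. Qed.

Lemma hull_ge n (s : 'S_n) (k : 'I_n) : k <= hull s k.
Proof. by rewrite leq_min !running_max_ge. Qed.

Lemma hull_mono n (s : 'S_n) k l : k <= l -> hull s k <= hull s l.
Proof.
by move=> le_kl; have := running_max_mono s le_kl;
  have := running_max_mono s^-1 le_kl; rewrite /hull; lia.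
Qed.

Lemma hull_lt n (s : 'S_n) (k : 'I_n) : hull s k < n.
Proof.
have n_gt0 : 0 < n by apply: leq_ltn_trans (ltn_ord k).
by rewrite gtn_min running_max_lt.
Qed.

(** One of the two running maxima equals [k], so the segment up to [k] is stable and the other
    equals [k] too. *)
Lemma running_max_hull_fix n (s : 'S_n) (k : 'I_n) :
  hull s k = k -> running_max s k = k.
Proof.
move=> hk; apply/eqP; rewrite eqn_leq running_max_ge andbT.
have := @running_maxV_le n s^-1%g k; rewrite invgK.
by move: hk; rewrite /hull; lia.
Qed.

Lemma running_max_fixes n p (s : 'S_n) (k : 'I_n) :
  fixes_below p s -> k < p -> running_max s k = k.
Proof.
move=> fix_s lt_kp; apply/eqP; rewrite eqn_leq running_max_ge andbT.
apply/running_max_leP => i le_ik.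
by rewrite fix_s // (leq_ltn_trans le_ik).
Qed.

Lemma hull_fixes n p (s : 'S_n) (k : 'I_n) :
  fixes_below p s -> k < p -> hull s k = k.
Proof.
move=> fix_s lt_kp.
by rewrite /hull !(running_max_fixes (p := p)) ?minnn //; apply: fixes_belowV.
Qed.

(** * Multiplication by one cycle: running maxima and length *)

Lemma running_max_cycle n (p m : 'I_n) (s : 'S_n) (k : 'I_n) :
    p <= m -> fixes_below p.+1 s ->
  running_max (interval_cycle p m * s)%g k
    = running_max s (if p <= k < m then k.+1 else k).
Proof.
(* For [p <= k < m] the cycle carries the points up to [k] to those up to [k + 1] other than [p]; as
   [s p = p], omitting [p] does not affect the maximum. *)
move=> le_pm fix_s; apply/eqP; rewrite eqn_leq; apply/andP; split.
  apply/running_max_leP => i le_ik; rewrite permM; apply: leq_running_max.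
  rewrite interval_cycleE.
  split_ifs_lia.
apply/running_max_leP => i le_ik.
have [eq_ip|ne_ip] := eqVneq i p.
  rewrite eq_ip fix_s //; apply: leq_trans (running_max_ge _ k).
  by move: le_ik; rewrite eq_ip; case: ifP; lia.
rewrite -(permKV (interval_cycle p m) i) -(permM _ s); apply: leq_running_max.
move: ne_ip; rewrite interval_cycleVE // -val_eqE /=.
move: le_ik; split_ifs_lia.
Qed.

(** The inverse cycle sends [p] to [m] and otherwise only lowers values up to [m], so [m] is
    attained and larger values are unchanged. *)
Lemma running_max_cycleV n (p m : 'I_n) (s : 'S_n) (k : 'I_n) :
    p <= m -> fixes_below p.+1 s -> p <= k ->
  running_max (interval_cycle p m * s)^-1 k = maxn m (running_max s^-1 k).
Proof.
move=> le_pm fix_s le_pk; apply/eqP; rewrite eqn_leq; apply/andP; split.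
  apply/running_max_leP => i le_ik; rewrite permVM.
  have := leq_running_max s^-1 le_ik; rewrite interval_cycleVE //.
  split_ifs_lia.
have le_m : m <= running_max (interval_cycle p m * s)^-1 k.
  apply: leq_trans (leq_running_max _ le_pk).
  rewrite permVM (fixes_belowV fix_s) //.
  by rewrite interval_cycleVE // eqxx ltnn.
rewrite geq_max le_m; apply/running_max_leP => i le_ik.
have := leq_running_max (interval_cycle p m * s)^-1 le_ik.
rewrite permVM interval_cycleVE //.
split_ifs_lia.
Qed.

Lemma perm_lengthV n (s : 'S_n) : perm_length s^-1 = perm_length s.
Proof.
pose swap (q : 'I_n * 'I_n) := (s q.2, s q.1).
have swap_inj : injective swap.
  by move=> [a b] [c d] [/perm_inj -> /perm_inj ->].
rewrite /perm_length -[RHS](card_imset _ swap_inj); apply: eq_card => [[a b]].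
rewrite !inE /=; apply/idP/imsetP => [/andP[lt_ab lt_s]|[[c d]]].
  by exists (s^-1 b, s^-1 a)%g; rewrite ?inE /swap /= ?permKV ?lt_s.
by rewrite inE /= => /andP[lt_cd lt_s] [-> ->]; rewrite !permK lt_cd lt_s.
Qed.

Lemma card_ord_range n a b : b <= n -> #|[set k : 'I_n | a <= k < b]| = b - a.
Proof.
have card_lt c : c <= n -> #|[set k : 'I_n | k < c]| = c.
  move=> le_cn; rewrite -sum1_card (eq_bigl (fun k : 'I_n => k < c)).
    by rewrite -(big_ord_widen n (fun=> 1) le_cn) sum1_card card_ord.
  by move=> k; rewrite inE.
move=> le_bn.
(* Replacing [a] by [minn a b] covers the case [b < a], where both sides are 0. *)
have -> : [set k : 'I_n | a <= k < b]
    = [set k : 'I_n | k < b] :\: [set k : 'I_n | k < minn a b].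
  by apply/setP => k; rewrite !inE; lia.
rewrite cardsD (setIidPr _) ?card_lt //; first lia.
  by rewrite geq_min le_bn orbT.
by apply/subsetP => k; rewrite !inE; lia.
Qed.

Lemma fixes_below_gt n p (s : 'S_n) (k : 'I_n) :
  fixes_below p s -> p <= k -> p <= s k.
Proof.
move=> fix_s le_pk; rewrite leqNgt; apply/negP => lt_sk.
by have := fix_s _ lt_sk; move/perm_inj => eq_sk; rewrite eq_sk ltnNge le_pk in lt_sk.
Qed.

(** The product sends [m] to [p], the least value on the points from [p] on. So the pairs [(k, m)]
    with [p <= k < m] are [m - p] new inversions, and applying the cycle to both entries matches the
    others with the inversions of [s]. *)
Lemma perm_length_cycle n (p m : 'I_n) (s : 'S_n) :
    p <= m -> fixes_below p.+1 s ->
  perm_length (interval_cycle p m * s) = perm_length s + (m - p).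
Proof.
move=> le_pm fix_s; set R := interval_cycle p m.
have RE (k : 'I_n) := interval_cycleE p m k.
have RVE (k : 'I_n) := interval_cycleVE k le_pm.
have Rm : R m = p.
  by apply: val_inj; rewrite /= RE le_pm eqxx ltnn andbF.
have sp : s p = p by rewrite fix_s.
rewrite /perm_length -(cardsID [set q : 'I_n * 'I_n | q.2 == m]) addnC.
congr addn.
  pose move_R (q : 'I_n * 'I_n) := (R q.1, R q.2).
  have move_R_inj : injective move_R.
    by move=> [a b] [c d] [/perm_inj -> /perm_inj ->].
  rewrite -(card_imset _ move_R_inj); apply: eq_card => [[c d]].
  rewrite inE /=; apply/imsetP/andP => [[[a b]]|[lt_cd lt_s]].
    rewrite !inE /= !permM => /and3P[ne_bm lt_ab lt_s] [-> ->]; split=> //.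
    have ne_am : a != m.
      apply: contraTneq lt_s => eq_am; rewrite eq_am Rm sp -leqNgt.
      apply: ltnW; apply: fixes_below_gt => //; rewrite -/R RE.
      by move: ne_bm lt_ab; rewrite eq_am -val_eqE /=; split_ifs_lia.
    by move: ne_bm ne_am; rewrite -!val_eqE /= !RE; split_ifs_lia.
  (* An inversion of [s] lies entirely above [p], where the inverse cycle is increasing and avoids
     [m]. *)
  have lt_pc : p < c.
    rewrite ltnNge; apply/negP => le_cp.
    have sc : s c = c by apply: fix_s.
    have := fix_s (s d); rewrite sc in lt_s.
    move=> /(_ (leq_trans lt_s (leqW le_cp)))/perm_inj eq_sd.
    by move: lt_s; rewrite eq_sd; lia.
  exists ((R^-1)%g c, (R^-1)%g d); last by rewrite /move_R /= !permKV.
  rewrite !inE /= !permM !permKV lt_s -val_eqE /= !RVE.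
  by split_ifs_lia.
rewrite -(card_ord_range p (ltnW (ltn_ord m))).
have pair_inj : injective (fun k : 'I_n => (k, m)) by move=> x y [].
rewrite -(card_imset _ pair_inj); apply: eq_card => [[a b]].
rewrite !inE /=; apply/idP/imsetP => [/andP[/andP[lt_ab lt_s] /eqP eq_bm]|].
  exists a; last by rewrite eq_bm.
  rewrite inE; move: lt_ab lt_s; rewrite eq_bm !permM Rm sp => lt_am.
  rewrite lt_am andbT leqNgt => lt_s; apply/negP => lt_ap.
  have Ra : R a = a by apply: val_inj; rewrite /= RE; split_ifs_lia.
  by move: lt_s; rewrite Ra fix_s ?(leqW lt_ap) //; lia.
case=> k; rewrite inE => /andP[le_pk lt_km] [-> ->].
rewrite lt_km eqxx andbT /= !permM Rm sp.
by apply: fixes_below_gt => //; rewrite -/R RE le_pk lt_km.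
Qed.

(** * Transpositions in Bruhat order and smoothness *)

(** The counts of [tperm a b] are maximal except for [i], [j] both in the range from [a] to [b - 1],
    where they drop by one. A count of [s] is maximal iff one of [s([i])], [[j]] contains the other;
    on that square this is excluded once it is excluded at the corners [(a, b - 1)] and
    [(b - 1, a)]. *)
Lemma bruhat_le_tperm n (s : 'S_n) (a b : 'I_n) :
  a < b -> bruhat_le (tperm a b) s = (b <= hull s a).
Proof.
move=> lt_ab; set t := tperm a b.
have lt_b1n : b.-1 < n by apply: leq_ltn_trans (ltn_ord b); lia.
pose c := Ordinal lt_b1n.
have ta : t a = b by rewrite tpermL.
have tb : t b = a by rewrite tpermR.
have tE (k : 'I_n) : k != a -> k != b -> t k = k.
  by move=> ka kb; rewrite tpermD // eq_sym.
have card_im (u : 'S_n) (i : 'I_n) : #|u @: initial_segment i| = i.+1.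
  by rewrite card_imset ?card_initial_segment //; apply: perm_inj.
have card_noa (l : 'I_n) : a <= l -> #|initial_segment l :\ a| = l.
  move=> le_al; have := cardsD1 a (initial_segment l).
  by rewrite mem_initial_segment le_al card_initial_segment => -[].
have mem_im (i k : 'I_n) : (k \in t @: initial_segment i) = (t k <= i).
  by rewrite -{1}(tpermK a b k) mem_imset ?mem_initial_segment //; apply: perm_inj.
apply/idP/idP => [/forallP le_ts|le_b].
  (* If [b] exceeds a running maximum at [a], the count of [s] is maximal at a corner while that of
     [t] is not. *)
  rewrite leq_min; apply/andP; split; rewrite leqNgt; apply/negP => lt_b.
    have /forallP/(_ c) := le_ts a.
    have /setIidPl -> : s @: initial_segment a \subset initial_segment c.
      apply/subsetP => _ /imsetP[k le_ka ->]; move: le_ka.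
      rewrite !mem_initial_segment /= => le_ka.
      by have := leq_running_max s le_ka; lia.
    rewrite card_im; apply/negP; rewrite -leqNgt.
    rewrite -(card_noa a) // -[leqRHS](card_imset _ (@perm_inj _ t)) subset_leq_card //.
    apply/subsetP => k; rewrite in_setI mem_im mem_initial_segment => /andP[tk kc].
    rewrite -(tpermK a b k) imset_f // !inE tk andbT.
    apply: contraTneq kc => tka; rewrite -(tpermK a b k) -/t tka ta /=; lia.
  have /forallP/(_ a) := le_ts c.
  have /setIidPr -> : initial_segment a \subset s @: initial_segment c.
    apply/subsetP => k; rewrite mem_initial_segment => le_ka.
    rewrite -(permKV s k) imset_f // mem_initial_segment /=.
    by have := leq_running_max s^-1 le_ka; lia.
  rewrite card_initial_segment; apply/negP; rewrite -leqNgt.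
  rewrite -(card_noa a) // subset_leq_card //; apply/subsetP => k.
  rewrite !inE mem_im => /andP[tk ->]; rewrite andbT.
  by apply: contraTneq tk => ->; rewrite ta /=; lia.
apply/forallP => i; apply/forallP => j.
have lt_mn : minn i j < n by apply: leq_ltn_trans (ltn_ord i); apply: geq_minl.
(* The largest count possible at [(i, j)] is [l.+1]. *)
pose l := Ordinal lt_mn.
have le_min (u : 'S_n) :
    #|(u @: initial_segment i) :&: initial_segment j| <= l.+1.
  rewrite /= -minnSS leq_min -{1}(card_im u i) -(card_initial_segment j).
  by rewrite !subset_leq_card ?subsetIl ?subsetIr.
have [|not_in] := boolP ((a <= i < b) && (a <= j < b)).
  case/andP=> /andP[ai ib] /andP[aj jb].
  have le_l : l <= #|(t @: initial_segment i) :&: initial_segment j|.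
    have al : a <= l by rewrite /=; lia.
    rewrite -(card_noa l al) subset_leq_card //; apply/subsetP => k.
    rewrite in_setI mem_im !inE => /andP[ka kl].
    by rewrite tE -?val_eqE /=; move: ka kl; rewrite -?val_eqE /=; lia.
  apply: leq_trans le_l; rewrite -ltnS ltn_neqAle le_min andbT.
  (* A maximal count of [s] would put [s([i])] inside [[j]] or the reverse, against [le_b] and the
     monotonicity of running maxima. *)
  apply/eqP => card_s; move: le_b; rewrite leq_min => /andP[F_a G_a].
  have [le_ij|lt_ji] := leqP i j.
    have /setIidPl sub : (s @: initial_segment i) :&: initial_segment j
        = s @: initial_segment i.
      by apply/eqP; rewrite eqEcard subsetIl card_im card_s /=; lia.
    suff : running_max s i <= j by have := running_max_mono s ai; lia.
    apply/running_max_leP => k ki; rewrite -mem_initial_segment.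
    by apply: (subsetP sub); rewrite imset_f // mem_initial_segment.
  have /setIidPr sub : (s @: initial_segment i) :&: initial_segment j
      = initial_segment j.
    by apply/eqP; rewrite eqEcard subsetIr card_initial_segment card_s /=; lia.
  suff : running_max s^-1 j <= i by have := running_max_mono s^-1 aj; lia.
  apply/running_max_leP => k kj.
  have : k \in s @: initial_segment i.
    by apply: (subsetP sub); rewrite mem_initial_segment.
  by case/imsetP => x xi ->; rewrite permK -mem_initial_segment.
apply: leq_trans (le_min s) _; rewrite -card_initial_segment.
have tkE (k : 'I_n) :
    t k = (if k == a :> nat then b else if k == b :> nat then a else k) :> nat.
  case: eqP => [/val_inj -> //|/eqP ka]; first by rewrite ta.
  by case: eqP => [/val_inj -> //|/eqP kb]; rewrite ?tb ?tE.
have [b_j|not_bj] := leqP b j.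
  have [lt_ib|le_bi] := ltnP i b.
    (* The image of [[i]] may contain [b] in place of [a], hence not contain [[l]]; but all of it
       lies in [[j]]. *)
    rewrite (setIidPl _) ?card_im ?card_initial_segment /=; first lia.
    apply/subsetP => k; rewrite mem_im mem_initial_segment tkE.
    by split_ifs_lia.
  rewrite subset_leq_card //; apply/subsetP => k.
  by rewrite in_setI mem_im !mem_initial_segment tkE /=; split_ifs_lia.
rewrite subset_leq_card //; apply/subsetP => k.
rewrite in_setI mem_im !mem_initial_segment tkE /=; move: not_in; split_ifs_lia.
Qed.

Definition hull_excess n (s : 'S_n) : nat := \sum_(k < n) (hull s k - k).

Lemma tperm_lt_inj n :
  {in [set q : 'I_n * 'I_n | q.1 < q.2] &, injective (fun q => tperm q.1 q.2)}.
Proof.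
move=> [a b] [c d]; rewrite !inE /= => lt_ab lt_cd eq_t.
have := congr1 (fun u : 'S_n => u c) eq_t; rewrite tpermL.
case: tpermP => [-> -> //|eq_cb eq_ad|_ _ eq_cd].
  by move: lt_cd; rewrite eq_cb -eq_ad; lia.
by move: lt_cd; rewrite eq_cd ltnn.
Qed.

(** By [bruhat_le_tperm], the transpositions below [s] are the pairs [a < b <= hull s a]; the term
    of the excess at [a] counts the possible [b]. *)
Lemma smoothE n (s : 'S_n) :
  smooth s = (perm_length s == hull_excess s).
Proof.
rewrite /smooth; congr (_ == _).
pose Q := [set q : 'I_n * 'I_n | q.1 < q.2 & q.2 <= hull s q.1].
have -> : [set t in transpositions n | bruhat_le t s]
    = [set tperm q.1 q.2 | q in Q].
  apply/setP => t; rewrite !inE; apply/idP/imsetP; last first.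
    case=> [[a b]]; rewrite inE /= => /andP[lt_ab le_b] ->.
    rewrite bruhat_le_tperm // le_b andbT.
    apply/existsP; exists a; apply/existsP; exists b.
    by rewrite eqxx andbT -val_eqE neq_ltn lt_ab.
  case/andP=> /existsP[a /existsP[b /andP[ne_ab /eqP ->]]].
  have [lt_ab|lt_ba|/val_inj eq_ab] := ltngtP a b.
  - by rewrite bruhat_le_tperm // => le_b; exists (a, b); rewrite // inE lt_ab.
  - rewrite tpermC bruhat_le_tperm // => le_a.
    by exists (b, a); rewrite // inE lt_ba.
  - by rewrite eq_ab eqxx in ne_ab.
rewrite card_in_imset; last first.
  by move=> q r; rewrite !inE => /andP[? _] /andP[? _];
    apply: tperm_lt_inj; rewrite inE.
rewrite -sum1_card (eq_bigl (fun q : 'I_n * 'I_n => true && (q.1 < q.2 <= hull s q.1))).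
  rewrite -(pair_big_dep xpredT (fun a b : 'I_n => a < b <= hull s a)
    (fun _ _ => 1)) /=.
  apply: eq_bigr => a _; have := card_ord_range a.+1 (hull_lt s a).
  by rewrite subSS => <-; rewrite -sum1_card; apply: eq_bigl => b; rewrite inE.
by move=> q; rewrite inE.
Qed.

(** * Peeling off a cycle; Deodhar's inequality *)

Lemma hull_cycle_le n (p m : 'I_n) (s : 'S_n) (k : 'I_n) :
    p <= m -> fixes_below p.+1 s ->
  hull s k <= hull (interval_cycle p m * s) k.
Proof.
move=> le_pm fix_s; have [le_pk|lt_kp] := leqP p k.
  rewrite /hull running_max_cycle // running_max_cycleV //.
  have := @running_max_mono n s k (if p <= k < m then k.+1 else k).
  by case: ifP => _ mono; have := mono _; lia.
by rewrite (hull_fixes fix_s) ?hull_ge // ltnW.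
Qed.

Lemma fixes_below_cycle n (p m : 'I_n) (s : 'S_n) :
  p <= m -> fixes_below p.+1 s -> fixes_below p (interval_cycle p m * s)%g.
Proof.
move=> le_pm fix_s k lt_kp; rewrite permM.
have -> : interval_cycle p m k = k.
  by apply: val_inj; rewrite /= interval_cycleE; split_ifs_lia.
by apply: fix_s; apply: ltnW.
Qed.

(** The choice [m = s^-1 p] makes the remaining factor fix [p]. *)
Lemma peel_cycle n (p : 'I_n) (s : 'S_n) : fixes_below p s ->
  exists m : 'I_n, exists2 s' : 'S_n, p <= m /\ fixes_below p.+1 s'
    & s = (interval_cycle p m * s')%g.
Proof.
move=> fix_s; pose m := (s^-1)%g p.
have le_pm : p <= m by apply: fixes_below_gt (leqnn p); apply: fixes_belowV.
exists m, ((interval_cycle p m)^-1 * s)%g; last by rewrite mulKVg.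
split=> // k; rewrite ltnS leq_eqVlt => /orP[/eqP/val_inj ->|lt_kp].
  rewrite permM; have -> : (interval_cycle p m)^-1%g p = m.
    by apply: val_inj; rewrite /= interval_cycleVE // eqxx ltnn.
  by rewrite /m permKV.
rewrite permM -{2}(fix_s k lt_kp); congr (s _); apply: val_inj.
by rewrite /= interval_cycleVE //; split_ifs_lia.
Qed.

Lemma running_maxV_cycle_start n (p m : 'I_n) (s : 'S_n) :
    p <= m -> fixes_below p.+1 s ->
  running_max (interval_cycle p m * s)^-1 p = m.
Proof.
move=> le_pm fix_s; rewrite running_max_cycleV //.
by rewrite (running_max_fixes (p := p.+1)) //; [lia | apply: fixes_belowV].
Qed.

Lemma hull_excessV n (s : 'S_n) : hull_excess s^-1 = hull_excess s.
Proof. by apply: eq_bigr => k _; rewrite hullV. Qed.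

(** The bound on [m] makes [m] the hull of the product at [p], where that of [s] is [p]. The last
    sum collects the growth of the hull elsewhere. *)
Lemma hull_excess_cycle n (p m : 'I_n) (s : 'S_n) :
    p <= m -> fixes_below p.+1 s -> m <= running_max (interval_cycle p m * s) p ->
  hull_excess (interval_cycle p m * s) = hull_excess s + (m - p)
    + \sum_(k < n | k != p) (hull (interval_cycle p m * s) k - hull s k).
Proof.
move=> le_pm fix_s le_m; rewrite /hull_excess (bigD1 p) //= [in RHS](bigD1 p) //=.
rewrite (hull_fixes fix_s) // {1}/hull running_maxV_cycle_start //.
rewrite (minn_idPr le_m) subnn add0n addnAC addnC; congr addn.
rewrite -big_split; apply: eq_bigr => k _ /=.
have := hull_cycle_le k le_pm fix_s.
have := hull_ge s k; lia.
Qed.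

Lemma fixes_below_all n p (s : 'S_n) : n <= p -> fixes_below p s -> s = 1%g.
Proof.
move=> le_np fix_s; apply/permP => k; rewrite perm1 fix_s //.
exact: leq_trans (ltn_ord k) le_np.
Qed.

Lemma perm_length1 n : perm_length (1%g : 'S_n) = 0.
Proof.
apply/eqP; rewrite cards_eq0; apply/eqP/setP => q; rewrite !inE !perm1; lia.
Qed.

(* Deodhar's inequality for the symmetric group, since [hull_excess s] counts
   the transpositions below s. *)
Lemma perm_length_le_hull_excess n (s : 'S_n) : perm_length s <= hull_excess s.
Proof.
(* Downward induction on the number [p] of fixed initial points, with [d] bounding the points
   left. *)
suff main d p (t : 'S_n) : n <= p + d -> fixes_below p t ->
    perm_length t <= hull_excess t.
  exact: (main n 0).
elim: d p t => [|d IHd] p t.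
  rewrite addn0 => le_np /(fixes_below_all le_np) ->.
  by rewrite perm_length1.
move=> le_n fix_t; have [le_np|lt_pn] := leqP n p.
  by rewrite (fixes_below_all le_np fix_t) perm_length1.
pose q := Ordinal lt_pn.
(* Passing to the inverse changes neither side, so the maximum of the inverse at [q], which is [m]
   below, may be taken to be the smaller one. *)
wlog le_VF : t fix_t / running_max t^-1 q <= running_max t q.
  move=> th; have [/th->//|/ltnW le_FV] := leqP (running_max t^-1 q) (running_max t q).
  rewrite -perm_lengthV -hull_excessV; apply: th; first exact: fixes_belowV.
  by rewrite invgK.
have [m [t' [le_qm fix_t'] eq_t]] := @peel_cycle n q t fix_t.
move: le_VF; rewrite eq_t running_maxV_cycle_start // => le_m.
rewrite hull_excess_cycle // perm_length_cycle //.
have := IHd p.+1 t'; rewrite addSnnS => /(_ le_n fix_t'); lia.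
Qed.

(** The length grows by exactly [m - p], the excess by [m - p] plus the growth of the hull off [p].
    By the inequality for [s], equality for the product leaves no slack in either. *)
Lemma hull_cycle_smooth n (p m : 'I_n) (s : 'S_n) :
    p <= m -> fixes_below p.+1 s -> m <= running_max (interval_cycle p m * s) p ->
    perm_length (interval_cycle p m * s) = hull_excess (interval_cycle p m * s) ->
  perm_length s = hull_excess s
  /\ forall k : 'I_n, k != p -> hull s k = hull (interval_cycle p m * s) k.
Proof.
move=> le_pm fix_s le_m; rewrite hull_excess_cycle // perm_length_cycle // => eq_len.
have le_len := perm_length_le_hull_excess s.
split=> [|k kp]; first lia.
have /eqP : \sum_(k < n | k != p) (hull (interval_cycle p m * s) k - hull s k) = 0 by lia.
rewrite sum_nat_eq0 => /forallP/(_ k)/implyP/(_ kp).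
have := hull_cycle_le k le_pm fix_s; lia.
Qed.

(* Generalizing also identifies occurrences that are only convertible, which
   lia would treat as distinct atoms. *)
Local Ltac running_max_lia :=
  rewrite ?/hull /=;
  repeat match goal with
  | |- context [running_max ?s ?k] => move: (running_max s k) => ?
  end; lia.

(** * Paths and the permutations compatible with them *)

Lemma dyck_pathP n (f : {ffun 'I_n -> 'I_n}) :
  reflect ((forall i : 'I_n, i <= f i)
             /\ (forall i j : 'I_n, i <= j -> f i <= f j))
    (dyck_path f).
Proof.
apply: (iffP andP) => -[ge_f mono_f]; split.
- exact/forallP.
- by move=> i j le_ij; move/forallP/(_ i)/forallP/(_ j)/implyP: mono_f; apply.
- exact/forallP.
- by apply/forallP => i; apply/forallP => j; apply/implyP; apply: mono_f.
Qed.

(* Condition (2) on decorations.  Without condition (1) it is invariant under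
   flipping g, which corresponds to inverting the permutation. *)
Definition locally_constant n (f : {ffun 'I_n -> 'I_n}) (g : 'I_n -> bool) : Prop :=
  forall i i' : 'I_n, i' = i.+1 :> nat -> f i' < f (f i) -> g i = g i'.

(* How (f, g) is read off its permutation: g i tells which of the two running
   maxima attains the hull, as long as they differ. *)
Definition compatible n (f : {ffun 'I_n -> 'I_n}) (g : 'I_n -> bool)
    (s : 'S_n) : Prop :=
  (forall k : 'I_n, hull s k = f k)
  /\ (forall k : 'I_n, f (f k) != f k ->
        if g k then running_max s k < running_max s^-1 k
        else running_max s^-1 k < running_max s k).

Lemma compatibleV n (f : {ffun 'I_n -> 'I_n}) (g : 'I_n -> bool) (s : 'S_n) :
  compatible f g s -> compatible f (fun k => ~~ g k) s^-1.
Proof.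
case=> hull_s cmp_s; split=> k; first by rewrite hullV.
by move/cmp_s; rewrite invgK; case: (g k).
Qed.

(** The cycle shifts [running_max s] by one between [p] and [f p], and replaces the maximum of the
    inverse by its maximum with [f p], a change at [p] only. Condition (2) ensures that beyond [p]
    the shift spoils neither the hull nor the strict comparisons. *)
Lemma compatible_cycle n (f f' : {ffun 'I_n -> 'I_n}) (g : 'I_n -> bool)
    (p : 'I_n) (s : 'S_n) :
    dyck_path f -> locally_constant f g -> (forall k : 'I_n, k < p -> f k = k) ->
    f' p = p -> (forall k : 'I_n, k != p -> f' k = f k) -> g p = false ->
    fixes_below p.+1 s -> compatible f' g s ->
  compatible f g (interval_cycle p (f p) * s)%g.
Proof.
move=> /dyck_pathP[ge_f mono_f] loc_g fix_f f'p f'E gp fix_s [hull_s cmp_s].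
have [eq_fp|ne_fp] := eqVneq (f p) p.
  rewrite eq_fp interval_cycle_id mul1g.
  suff -> : f = f' by [].
  by apply/ffunP => k; case: (eqVneq k p) => [->|/f'E //]; rewrite f'p.
have lt_pm : p < f p by rewrite ltn_neqAle ge_f andbT eq_sym val_eqE.
have le_pm := ltnW lt_pm.
have f'_gt (k : 'I_n) : p < k -> f' k = f k.
  by move=> lt_pk; rewrite f'E // -val_eqE neq_ltn lt_pk orbT.
have h_gt (k : 'I_n) : p < k -> hull s k = f k by move=> /f'_gt <-; apply: hull_s.
have le_mf (k : 'I_n) : p <= k -> f p <= f k by apply: mono_f.
have cmp_gt (k : 'I_n) : p < k -> f (f k) != f k ->
    if g k then running_max s k < running_max s^-1 k
    else running_max s^-1 k < running_max s k.
  move=> lt_pk ne_fk; apply: cmp_s; rewrite f'_gt // f'_gt //.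
  exact: leq_trans (ge_f k).
(* Condition (2) carries the value [g p = false] to the right as long as [f k < f (f p)]. *)
have g_false d (k : 'I_n) : k = p + d :> nat -> k <= f p -> f k < f (f p) ->
    g k = false.
  elim: d k => [|d IHd] k eq_k le_km lt_fk.
    by rewrite (_ : k = p) //; apply: val_inj; rewrite /= eq_k addn0.
  have lt_k1 : k.-1 < n by apply: leq_ltn_trans (ltn_ord k); lia.
  pose l := Ordinal lt_k1.
  have le_lk : l <= k by rewrite /=; lia.
  rewrite -(loc_g l) ?IHd //=; try lia.
    exact: leq_ltn_trans (mono_f _ _ le_lk) lt_fk.
  by apply: leq_trans lt_fk (mono_f _ _ (le_mf _ _)); rewrite /=; lia.
have step (k : 'I_n) : p < k -> k < f p ->
  minn (running_max s k.+1) (running_max s^-1 k)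
    = minn (running_max s k) (running_max s^-1 k)
  /\ (f (f k) != f k -> g k -> running_max s k.+1 = running_max s k).
  move=> lt_pk lt_km.
  have lt_k1 : k.+1 < n by apply: leq_ltn_trans (ltn_ord (f p)).
  pose l := Ordinal lt_k1.
  have le_kl : k <= l by rewrite /=.
  have le_lm : l <= f p by [].
  have lt_pl : p < l by rewrite /=; lia.
  have le_Fkl := running_max_mono s le_kl.
  have hk := h_gt k lt_pk; have hl := h_gt l lt_pl.
  have le_mm := le_mf k (ltnW lt_pk).
  (* If [f] fixes [f k], then [s] preserves the segment up to [f k], which contains [k + 1]. *)
  have [closed|open] := eqVneq (f (f k)) (f k).
    split=> //; suff : running_max s k.+1 <= f k by move: hk le_Fkl; running_max_lia.
    have fc : running_max s (f k) = f k.
      apply: running_max_hull_fix; rewrite h_gt ?closed //.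
      exact: leq_trans (ge_f k).
    by rewrite -[leqRHS]fc running_max_mono //; apply: leq_trans le_mm.
  have := cmp_gt k lt_pk open; case gk: (g k) => cmp_k; last first.
    by split=> //; move: hk le_Fkl cmp_k; running_max_lia.
  (* As [g k] is true, [g_false] forces this equality; so [f] is constant from [k] to [f p], and
     [running_max s] attains the same hull at [k] and [k + 1]. *)
  have eq_fk : f k = f (f p).
    apply/val_inj/eqP; rewrite /= eqn_leq (mono_f k (f p)) ?(ltnW lt_km) //= leqNgt.
    apply/negP => lt_fk; move: gk; rewrite (g_false (k - p)) // ?(ltnW lt_km) //.
    by rewrite subnKC // ltnW.
  have eq_fl : f l = f k.
    apply/val_inj/eqP; rewrite /= eqn_leq (mono_f k l) // andbT.
    by rewrite eq_fk mono_f.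
  have gl : g l.
    rewrite -(loc_g k l) // eq_fl ltn_neqAle eq_sym val_eqE open.
    exact: ge_f.
  have := cmp_gt l lt_pl; rewrite eq_fl gl => /(_ open) cmp_l.
  have : running_max s k.+1 = running_max s k.
    by move: hk hl cmp_k cmp_l; rewrite eq_fl; running_max_lia.
  by move=> eq_F; split=> //; rewrite eq_F.
have hull_m (k : 'I_n) : p < k -> f p <= running_max s^-1 k.
  by move=> lt_pk; have := h_gt k lt_pk; have := le_mf k (ltnW lt_pk);
    running_max_lia.
split=> k.
  have [lt_kp|lt_pk|/val_inj ->] := ltngtP k p.
  - rewrite (fix_f k) //; apply: (hull_fixes (p := p)) => //.
    exact: fixes_below_cycle.
  - have le_pk := ltnW lt_pk.
    rewrite /hull running_max_cycle // running_max_cycleV //.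
    have := h_gt k lt_pk; have := hull_m k lt_pk; have := step k lt_pk.
    by case: ifP => [/andP[_ lt_km] /(_ lt_km)[]|_ _]; running_max_lia.
  - rewrite /hull running_maxV_cycle_start // running_max_cycle //.
    rewrite leqnn lt_pm.
    have lt_p1 : p.+1 < n by apply: leq_ltn_trans (ltn_ord (f p)).
    have := h_gt (Ordinal lt_p1) (leqnn _).
    by have := le_mf (Ordinal lt_p1) (leqnSn _); running_max_lia.
have [lt_kp|lt_pk|/val_inj ->] := ltngtP k p.
- by rewrite !(fix_f k) ?eqxx.
- have le_pk := ltnW lt_pk; move=> open; have := cmp_gt k lt_pk open.
  rewrite running_max_cycle // running_max_cycleV //.
  have := @running_max_mono n s k k.+1 (leqnSn _).
  have := hull_m k lt_pk; have := step k lt_pk.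
  rewrite le_pk /=; have [lt_km /(_ isT)[_ /(_ open)]|_ _] := ltnP k (f p).
    by case: (g k) => [->|_] //; running_max_lia.
  by case: (g k); running_max_lia.
- move=> open; rewrite gp running_maxV_cycle_start //.
  rewrite running_max_cycle // leqnn lt_pm.
  have lt_p1 : p.+1 < n by apply: leq_ltn_trans (ltn_ord (f p)).
  pose l := Ordinal lt_p1.
  have := h_gt l (leqnn _); have := le_mf l (leqnSn _).
  have [lt_ml|le_lm] := ltnP (f p) (f l); first by running_max_lia.
  (* Condition (2) now transfers [g p = false] to [l = p + 1], whose strict comparison is the one
     wanted at [p]. *)
  move=> le_ml; have eq_fl : f l = f p by apply/val_inj/eqP; rewrite eqn_leq le_lm.
  have gl : g l = false.
    rewrite -(loc_g p l) // eq_fl ltn_neqAle eq_sym val_eqE open.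
    exact: ge_f.
  have := cmp_gt l (leqnn _); rewrite gl eq_fl => /(_ open).
  by running_max_lia.
Qed.

(** * Splitting off the first factor; the permutation of a path *)

Lemma prod_ord_peel n (gT : finGroupType) (F F' : 'I_n -> gT) (p : 'I_n) :
    (forall k : 'I_n, k < p -> F k = 1%g) ->
    (forall k : 'I_n, k <= p -> F' k = 1%g) ->
    (forall k : 'I_n, p < k -> F' k = F k) ->
  (\prod_(k < n) F k = F p * \prod_(k < n) F' k)%g.
Proof.
(* Extending the factors by 1 to all natural numbers lets the ordered product be cut at [p]. *)
move=> F_lt F'_le F'_gt; pose N (G : 'I_n -> gT) i := oapp G 1%g (insub i).
have prodN G : (\prod_(k < n) G k = \prod_(0 <= i < n) N G i)%g.
  by rewrite big_mkord; apply: eq_bigr => k _; rewrite /N valK.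
have NE G (i : nat) (lt_in : i < n) : N G i = G (Ordinal lt_in).
  by rewrite /N insubT.
have prod1 G m : m <= n -> (forall k : 'I_n, k < m -> G k = 1%g) ->
    (\prod_(0 <= i < m) N G i = 1)%g.
  move=> le_mn G1; rewrite big_nat big1 // => i /andP[_ lt_im].
  by rewrite (NE _ _ (leq_trans lt_im le_mn)) G1.
have lt_pn := ltn_ord p.
rewrite !prodN (big_cat_nat _ (ltnW lt_pn)) //= prod1 ?(ltnW lt_pn) // mul1g.
rewrite big_ltn // [in RHS](big_cat_nat _ lt_pn) //= prod1 // mul1g.
congr (_ * _)%g; first by rewrite (NE _ _ lt_pn); congr (F _); apply: val_inj.
apply: eq_big_nat => i /andP[lt_pi lt_in].
by rewrite !(NE _ _ lt_in) F'_gt.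
Qed.

(** The cycles before [p] are trivial, so the one at [p] comes first in its product; if [g p] is
    true that product is inverted and the inverse cycle comes last. As [f'] fixes [p], the value
    [g' p] is free. *)
Lemma dyck_perm_peel n (f f' : {ffun 'I_n -> 'I_n}) (g g' : {ffun 'I_n -> bool})
    (p : 'I_n) :
    (forall k : 'I_n, k < p -> f k = k) ->
    (forall k : 'I_n, k <= p -> f' k = k) ->
    (forall k : 'I_n, p < k -> f' k = f k /\ g' k = g k) ->
  dyck_perm (f, g) =
    if g p then (dyck_perm (f', g') * (interval_cycle p (f p))^-1)%g
    else (interval_cycle p (f p) * dyck_perm (f', g'))%g.
Proof.
move=> f_lt f'_le fg'_gt.
have peel b : (\prod_(i < n | g i == b) interval_cycle i (f i)
    = (if g p == b then interval_cycle p (f p) else 1)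
      * \prod_(i < n | g' i == b) interval_cycle i (f' i))%g.
  rewrite big_mkcond [in RHS]big_mkcond.
  rewrite (prod_ord_peel (p := p)
    (F' := fun i => if g' i == b then interval_cycle i (f' i) else 1%g)) //.
  - by move=> k /f_lt ->; rewrite interval_cycle_id if_same.
  - by move=> k /f'_le ->; rewrite interval_cycle_id if_same.
  - by move=> k /fg'_gt[-> ->].
rewrite /dyck_perm !peel; case: (g p) => /=.
  by rewrite mul1g invMg mulgA.
by rewrite mul1g mulgA.
Qed.

Definition dyck_tail n (f : {ffun 'I_n -> 'I_n}) (p : 'I_n) : {ffun 'I_n -> 'I_n} :=
  [ffun k => if k == p then p else f k].

Lemma dyck_tail_path n (f : {ffun 'I_n -> 'I_n}) (p : 'I_n) :
    dyck_path f -> (forall k : 'I_n, k < p -> f k = k) ->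
  dyck_path (dyck_tail f p).
Proof.
move=> /dyck_pathP[ge_f mono_f] f_lt; apply/dyck_pathP; split=> [i|i j le_ij].
  by rewrite ffunE; case: eqP => [->|].
rewrite !ffunE; case: eqP => [eq_i|/eqP ne_i]; case: eqP => [eq_j|/eqP ne_j] //.
- by apply: leq_trans (ge_f j); rewrite -eq_i.
- rewrite f_lt -?eq_j // ltn_neqAle le_ij andbT.
  by rewrite eq_j.
- exact: mono_f.
Qed.

(** For [i <= p] the tail [h] has [h (h i) = i < h i'], so the condition is vacuous; beyond [p]
    nothing changes. Condition (1) can fail for the tail at [p], so the induction carries condition
    (2) alone. *)
Lemma dyck_tail_constant n (f : {ffun 'I_n -> 'I_n}) (g : 'I_n -> bool) (p : 'I_n) :
    dyck_path f -> (forall k : 'I_n, k < p -> f k = k) ->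
  locally_constant f g -> locally_constant (dyck_tail f p) g.
Proof.
move=> path_f f_lt loc_g i i' eq_i'.
have /dyck_pathP[ge_f' _] := dyck_tail_path path_f f_lt.
have /dyck_pathP[ge_f _] := path_f.
have := ge_f' i'; have [lt_ip|lt_pi|/val_inj eq_ip] := ltngtP i p.
- have f'i : dyck_tail f p i = i.
    by rewrite ffunE f_lt // -val_eqE (ltn_eqF lt_ip).
  by rewrite !f'i; lia.
- have f'_gt (k : 'I_n) : p < k -> dyck_tail f p k = f k.
    by move=> lt_pk; rewrite ffunE -val_eqE (gtn_eqF lt_pk).
  rewrite !f'_gt //; first by move=> _; apply: loc_g.
    exact: leq_trans (ge_f i).
  by rewrite eq_i' ltnW.
- move: eq_i'; rewrite eq_ip [dyck_tail f p p]ffunE eqxx [dyck_tail f p p]ffunE eqxx => ->; lia.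
Qed.

(** Downward induction on the number of fixed initial points of the path: the cycle at [q] is added
    to the permutation of the tail. Decoration 1 at [q] reduces to decoration 0 by inverting the
    permutation and flipping [g]. *)
Lemma dyck_perm_spec n (f : {ffun 'I_n -> 'I_n}) (g : {ffun 'I_n -> bool}) :
    dyck_path f -> locally_constant f g ->
  compatible f g (dyck_perm (f, g))
  /\ perm_length (dyck_perm (f, g)) = \sum_(k < n) (f k - k).
Proof.
move=> path_f loc_g.
suff main d p (h : {ffun 'I_n -> 'I_n}) : n <= p + d ->
    (forall k : 'I_n, k < p -> h k = k) -> dyck_path h -> locally_constant h g ->
    [/\ fixes_below p (dyck_perm (h, g)), compatible h g (dyck_perm (h, g))
      & perm_length (dyck_perm (h, g)) = \sum_(k < n) (h k - k)].
  by case: (@main n 0 f (leqnn n) _ path_f loc_g).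
elim: d p h => [|d IHd] p h le_n h_lt path_h loc_h.
  have h_id k : h k = k.
    by apply: h_lt; apply: leq_trans (ltn_ord k) _; rewrite addn0 in le_n.
  have -> : dyck_perm (h, g) = 1%g.
    rewrite /dyck_perm !big1 ?invg1 ?mulg1 // => i _;
      by rewrite h_id interval_cycle_id.
  split; first by move=> k _; rewrite perm1.
    split=> k; last by rewrite !h_id eqxx.
    by rewrite h_id (hull_fixes (p := n)) // => l _; rewrite perm1.
  by rewrite perm_length1 big1 // => i _; rewrite h_id subnn.
have [le_np|lt_pn] := leqP n p.
  by apply: IHd => //; lia.
pose q := Ordinal lt_pn; pose h' := dyck_tail h q.
have h'_le (k : 'I_n) : k <= q -> h' k = k.
  rewrite ffunE leq_eqVlt -val_eqE /=; case: eqP => [/esym eq_k _|_ /h_lt //].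
  exact: val_inj.
have [fix_s' cmp_s' len_s'] : [/\ fixes_below p.+1 (dyck_perm (h', g)),
    compatible h' g (dyck_perm (h', g))
  & perm_length (dyck_perm (h', g)) = \sum_(k < n) (h' k - k)].
  apply: IHd; [by rewrite addSnnS | by move=> k; apply: h'_le | |].
    exact: dyck_tail_path.
  exact: dyck_tail_constant.
have h'_gt (k : 'I_n) : q < k -> h' k = h k /\ g k = g k.
  by move=> lt_qk; rewrite ffunE -val_eqE (gtn_eqF lt_qk).
have h'E (k : 'I_n) : k != q -> h' k = h k by move=> /negbTE ne_k; rewrite ffunE ne_k.
have h'q : h' q = q by rewrite ffunE eqxx.
have /dyck_pathP[ge_h _] := path_h.
have sumE : \sum_(k < n) (h k - k) = \sum_(k < n) (h' k - k) + (h q - q).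
  rewrite (bigD1 q) //= [in RHS](bigD1 q) //= h'q subnn add0n addnC.
  by congr addn; apply: eq_bigr => k /h'E ->.
rewrite (dyck_perm_peel (f' := h') (g' := g) (p := q)) //.
set s' := dyck_perm (h', g) in fix_s' cmp_s' len_s' *.
case gq: (g q); last first.
  split; first exact: (fixes_below_cycle (p := q)).
    exact: compatible_cycle cmp_s'.
  by rewrite perm_length_cycle // len_s' sumE.
have -> : (s' * (interval_cycle q (h q))^-1 = (interval_cycle q (h q) * s'^-1)^-1)%g.
  by rewrite invMg invgK.
have fix_V : fixes_below q.+1 s'^-1%g by apply: fixes_belowV.
split; first by apply: fixes_belowV; apply: (fixes_below_cycle (p := q)).
  have [|hull_s cmp_s] := compatibleV (@compatible_cycle n h h' (fun k => ~~ g k)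
      q s'^-1 path_h _ h_lt h'q h'E (congr1 negb gq) fix_V (compatibleV cmp_s')).
    by move=> i i' eq_i' lt_h; rewrite (loc_h i i').
  by split=> // k /cmp_s; rewrite negbK.
by rewrite perm_lengthV perm_length_cycle // perm_lengthV len_s' sumE.
Qed.

Lemma perm_length_dyck_factor n (f : {ffun 'I_n -> 'I_n}) (g : {ffun 'I_n -> bool})
    (i : 'I_n) :
  dyck_path f -> perm_length (dyck_factor f g i) = f i - i.
Proof.
move=> /dyck_pathP[ge_f _].
have len : perm_length (interval_cycle i (f i)) = f i - i.
  rewrite -[interval_cycle _ _]mulg1 perm_length_cycle ?perm_length1 //.
  by move=> k _; rewrite perm1.
by rewrite /dyck_factor; case: (g i); rewrite ?perm_lengthV.
Qed.

Lemma decorated_dyck_pathP n (f : {ffun 'I_n -> 'I_n}) (g : {ffun 'I_n -> bool}) :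
  reflect [/\ dyck_path f, (forall i, f (f i) = f i -> g i = false)
            & locally_constant f g]
    ((f, g) \in decorated_dyck_path n).
Proof.
rewrite inE; apply: (iffP and3P) => -[path_f closed_g loc_g]; split=> //.
- by move=> i eq_i; apply/eqP; move/forallP/(_ i)/implyP: closed_g; apply; apply/eqP.
- move=> i i' eq_i' lt_f; apply/eqP.
  move/forallP/(_ i)/forallP/(_ i')/implyP: loc_g; apply.
  by rewrite eq_i' eqxx.
- by apply/forallP => i; apply/implyP => /eqP/closed_g ->.
- apply/forallP => i; apply/forallP => i'; apply/implyP => /andP[/eqP eq_i' lt_f].
  by rewrite (loc_g i i').
Qed.

(** * Injectivity and surjectivity *)

Lemma dyck_perm_inj n : {in decorated_dyck_path n &, injective (@dyck_perm n)}.
Proof.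
move=> [f g] [f' g'] /decorated_dyck_pathP[path_f closed_g loc_g].
move=> /decorated_dyck_pathP[path_f' closed_g' loc_g'] eq_s.
have [[hull_s cmp_s] _] := dyck_perm_spec path_f loc_g.
have [[hull_s' cmp_s'] _] := dyck_perm_spec path_f' loc_g'.
have eq_f : f = f'.
  by apply/ffunP => k; apply: val_inj; rewrite /= -hull_s eq_s hull_s'.
move: closed_g' cmp_s'; rewrite -eq_s -eq_f => closed_g' cmp_s'.
congr pair => //; apply/ffunP => k.
(* Condition (1) settles the decoration at closed points, the strict comparison of running maxima at
   the others. *)
have [closed|open] := eqVneq (f (f k)) (f k).
  by rewrite closed_g ?closed_g'.
have := cmp_s k open; have := cmp_s' k open.
by case: (g k); case: (g' k) => // lt1 lt2; have := ltn_trans lt1 lt2; rewrite ltnn.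
Qed.

(** This gives condition (2) at [p] for surjectivity. If [g l] were true, [running_max s] would lie
    below the maximum of the inverse at [l]; as the cycle keeps the hull off [p], it would stay
    constant up to [m], whence [f m <= f l]. *)
Lemma compatible_hull_constant n (p m l : 'I_n) (s : 'S_n)
    (f : {ffun 'I_n -> 'I_n}) (g : 'I_n -> bool) :
    p < m -> fixes_below p.+1 s -> m <= running_max (interval_cycle p m * s) p ->
    (forall k : 'I_n, k != p -> hull s k = hull (interval_cycle p m * s) k) ->
    dyck_path f -> compatible f g s -> l = p.+1 :> nat -> f l < f m ->
  g l = false.
Proof.
move=> lt_pm fix_s le_m eq_hull /dyck_pathP[ge_f mono_f] [hull_s cmp_s] eq_l lt_f.
have le_pm := ltnW lt_pm.
have le_mf (k : 'I_n) : p < k -> m <= hull s k.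
  move=> lt_pk; rewrite eq_hull -?val_eqE /= ?(gtn_eqF lt_pk) //.
  apply: leq_trans (hull_mono _ (ltnW lt_pk)).
  by rewrite /hull running_maxV_cycle_start // leq_min le_m leqnn.
have lt_pl : p < l by rewrite eq_l.
have le_mfl : m <= f l by rewrite -hull_s le_mf.
apply/negP => gl; have := cmp_s l; rewrite gl => cmp_l.
have {cmp_l} lt_FG : running_max s l < running_max s^-1 l.
  apply: cmp_l; rewrite -val_eqE gtn_eqF //.
  exact: leq_trans lt_f (mono_f _ _ le_mfl).
have eq_F d (k : 'I_n) : k = l + d :> nat -> k <= m ->
    running_max s k = running_max s l.
  elim: d k => [|d IHd] k eq_k le_km; first by rewrite eq_k addn0.
  have lt_k1 : k.-1 < n by apply: leq_ltn_trans (ltn_ord k); lia.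
  pose j := Ordinal lt_k1.
  have lt_pj : p < j by rewrite /=; lia.
  have le_pj := ltnW lt_pj.
  have eq_Fj : running_max s j = running_max s l by apply: IHd; rewrite /=; lia.
  have le_G := @running_max_mono n s^-1 l j.
  (* The hull at [j] is the same before and after the shift, and the maximum of the inverse exceeds
     it; so [running_max s] cannot grow from [j] to [k]. *)
  have := eq_hull j; rewrite -val_eqE (gtn_eqF lt_pj) => /(_ isT).
  rewrite /hull running_max_cycle // running_max_cycleV //.
  have -> : (if p <= j < m then j.+1 else j) = k by rewrite /=; case: ifP; lia.
  have := le_mf j lt_pj; rewrite -eq_Fj in lt_FG *.
  move: lt_FG le_G; rewrite /hull; set y := running_max s^-1 j.
  set x := running_max s j; set z := running_max s k; set w := running_max _ l.
  by move=> lt_xw le_wy; have /le_wy : l <= j; rewrite /=; lia.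
have := hull_s m; have := hull_s l.
have := eq_F (m - l) m; rewrite subnKC ?eq_l // => /(_ erefl (leqnn _)).
by move: lt_f lt_FG; rewrite -eq_l; running_max_lia.
Qed.

(** The cycle at [p] is peeled off [s], or off [s^-1] if the latter has the larger running maximum
    at [p]; the path gets the value [m] and the decoration [b] there. *)
Lemma dyck_perm_surj n d p (s : 'S_n) :
    n <= p + d -> fixes_below p s -> perm_length s = hull_excess s ->
  exists f g, [/\ (f, g) \in decorated_dyck_path n,
    (forall k : 'I_n, k < p -> f k = k) & dyck_perm (f, g) = s].
Proof.
elim: d p s => [|d IHd] p s.
  rewrite addn0 => le_np /(fixes_below_all le_np) -> _.
  exists [ffun k => k], [ffun=> false]; split=> [||]; last first.
  - by rewrite /dyck_perm !big1 ?invg1 ?mulg1 // => i _;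
      rewrite ffunE interval_cycle_id.
  - by move=> k _; rewrite ffunE.
  - apply/decorated_dyck_pathP; split.
    + by apply/dyck_pathP; split=> [i|i j]; rewrite !ffunE.
    + by move=> i _; rewrite ffunE.
    + by move=> i i' _ _; rewrite !ffunE.
move=> le_n fix_s len_s; have [le_np|lt_pn] := leqP n p.
  by apply: IHd => //; lia.
pose q := Ordinal lt_pn.
(* The comparison is strict, so a tie gets decoration 0. *)
pose b := running_max s q < running_max s^-1 q.
pose t := if b then s^-1%g else s.
have fix_t : fixes_below q t.
  by rewrite /t; case: (b) => //; apply: fixes_belowV.
have len_t : perm_length t = hull_excess t.
  by rewrite /t; case: (b); rewrite // perm_lengthV hull_excessV.
(* Adding [b] records strictness in the inverted case. *)
have le_GF : running_max t^-1 q + b <= running_max t q.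
  by rewrite /t /b; case: ltnP; rewrite ?invgK ?addn0 ?addn1.
have [m [t' [le_qm fix_t'] eq_t]] := peel_cycle fix_t.
rewrite eq_t running_maxV_cycle_start // in len_t le_GF.
have le_m : m <= running_max (interval_cycle q m * t') q.
  by apply: leq_trans le_GF; apply: leq_addr.
have [len_t' eq_hull] := hull_cycle_smooth le_qm fix_t' le_m len_t.
pose s' := if b then t'^-1%g else t'.
have fix_s' : fixes_below p.+1 s'.
  by rewrite /s'; case: (b) => //; apply: fixes_belowV.
have len_s' : perm_length s' = hull_excess s'.
  by rewrite /s'; case: (b); rewrite // perm_lengthV hull_excessV.
have [|f' [g' [dec_fg' f'_le eq_s']]] := IHd p.+1 s' _ fix_s' len_s'.
  by rewrite addSnnS.
have /decorated_dyck_pathP[path_f' closed_g' loc_g'] := dec_fg'.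
have cmp_t' : compatible f' (fun k => if b then ~~ g' k else g' k) t'.
  have [] := dyck_perm_spec path_f' loc_g'; rewrite eq_s' /s' => cmp _.
  by move: cmp; case: (b) => // /compatibleV; rewrite invgK.
have /dyck_pathP[ge_f' _] := path_f'.
have f'q : f' q = q by apply: f'_le.
pose f : {ffun 'I_n -> 'I_n} := [ffun k => if k == q then m else f' k].
pose g : {ffun 'I_n -> bool} := [ffun k => if k == q then b else g' k].
have fq : f q = m by rewrite ffunE eqxx.
have gq : g q = b by rewrite ffunE eqxx.
have fE (k : 'I_n) : k != q -> f k = f' k by move=> /negbTE ne_k; rewrite ffunE ne_k.
have gE (k : 'I_n) : k != q -> g k = g' k by move=> /negbTE ne_k; rewrite ffunE ne_k.
have hull_m : hull (interval_cycle q m * t') q = m.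
  by rewrite /hull running_maxV_cycle_start //; apply/minn_idPr.
have hullE (k : 'I_n) : hull (interval_cycle q m * t') k = f k.
  have [->|ne_kq] := eqVneq k q; first by rewrite fq.
  by rewrite -eq_hull // fE //; case: cmp_t'.
have ffm : f m = f' m.
  by have [eq_mq|/fE //] := eqVneq m q; rewrite eq_mq fq f'q.
have ffE (i : 'I_n) : i != q -> f (f i) = f' (f' i).
  move=> ne_iq; rewrite (fE i) // fE //; move: ne_iq; rewrite -!val_eqE neq_ltn.
  case/orP=> [lt_iq|lt_qi]; first by rewrite f'_le ?(ltn_eqF lt_iq) // ltnW.
  by rewrite gtn_eqF //; apply: leq_trans (ge_f' i).
have path_f : dyck_path f.
  apply/dyck_pathP; split=> [i|i j le_ij]; rewrite -!hullE ?hull_ge //.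
  exact: hull_mono.
have /dyck_pathP[ge_f _] := path_f.
exists f, g; split.
- apply/decorated_dyck_pathP; split=> // [i|i i' eq_i'].
    have [->|ne_iq] := eqVneq i q.
      (* If [f m = m], the running maximum at [q] is at most the one at [m], which is [m]; this
         rules out [b]. *)
      rewrite fq gq => closed; apply: contraTF le_GF => ->; rewrite addn1 -ltnNge ltnS.
      have Fm : running_max (interval_cycle q m * t') m = m.
        by apply: running_max_hull_fix; rewrite hullE closed.
      by rewrite -[leqRHS]Fm; apply: running_max_mono.
    by rewrite ffE // fE // gE //; apply: closed_g'.
  have [eq_iq|ne_iq] := eqVneq i q.
    rewrite eq_iq fq gq ffm => lt_f.
    have ne_i'q : i' != q by rewrite -val_eqE /= eq_i' eq_iq gtn_eqF.
    rewrite fE // in lt_f; rewrite gE //.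
    have [lt_qm|le_mq] := ltnP q m; last first.
      have eq_mq : m = q by apply/val_inj/eqP; rewrite eqn_leq le_mq.
      by move: lt_f (ge_f' i'); rewrite eq_mq f'q eq_i' eq_iq => /ltn_trans lt /lt; rewrite ltnn.
    have eq_i'q : i' = q.+1 :> nat by rewrite eq_i' eq_iq.
    (* The decoration of [t'] is [g'] flipped according to [b], so its being false at [q + 1] means
       [g' i' = b]. *)
    have := compatible_hull_constant lt_qm fix_t' le_m eq_hull path_f' cmp_t' eq_i'q lt_f.
    by case: (b) (g' i') => -[].
  rewrite ffE // (gE i) //; have [eq_i'q|ne_i'q] := eqVneq i' q.
    have -> : f' i = i by apply: f'_le; rewrite ltnS -[leqRHS]/(q : nat) -eq_i'q eq_i'.
    rewrite f'_le; last by rewrite ltnS -[leqRHS]/(q : nat) -eq_i'q eq_i'.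
    by have := ge_f i'; rewrite eq_i'; lia.
  by rewrite fE // gE //; apply: loc_g'.
- move=> k lt_kp; rewrite fE ?(f'_le k (leqW lt_kp)) //.
  by rewrite -val_eqE ltn_eqF.
- rewrite (dyck_perm_peel (f' := f') (g' := g') (p := q)).
  + rewrite fq gq eq_s' /s'; move: eq_t; rewrite /t; case: (b) => eq_t.
      by rewrite -invMg -eq_t invgK.
    by rewrite eq_t.
  + by move=> k lt_kq; rewrite fE ?(f'_le k (leqW lt_kq)) // -val_eqE ltn_eqF.
  + by move=> k le_kq; apply: f'_le.
  + by move=> k lt_qk; rewrite fE ?gE // -val_eqE gtn_eqF.
Qed.

Theorem theorem1p4 (n : nat) (hn : 0 < n) :
  [/\ {in decorated_dyck_path n &, injective (@dyck_perm n)},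
      @dyck_perm n @: decorated_dyck_path n = [set s : 'S_n | smooth s]
    & forall (f : {ffun 'I_n -> 'I_n}) (g : {ffun 'I_n -> bool}),
        (f, g) \in decorated_dyck_path n ->
        perm_length (dyck_perm (f, g))
          = \sum_(i < n) perm_length (dyck_factor f g i)].
Proof.
split; first exact: dyck_perm_inj.
  apply/setP => s; rewrite inE smoothE; apply/imsetP/eqP => [[[f g]]|len_s].
    move=> /decorated_dyck_pathP[path_f _ loc_g] ->.
    have [[hull_s _] ->] := dyck_perm_spec path_f loc_g.
    by apply: eq_bigr => k _; rewrite hull_s.
  have [//|f [g [dec_fg _ <-]]] := @dyck_perm_surj n n 0 s (leqnn n) _ len_s.
  by exists (f, g).
move=> f g /decorated_dyck_pathP[path_f _ loc_g].
have [_ ->] := dyck_perm_spec path_f loc_g.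
by apply: eq_bigr => i _; rewrite perm_length_dyck_factor.
Qed.
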